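(* Let $k \geq 1$ and let $r \geq 2$ be even. Then \[ \mathrm{ex}_{\circlearrowright}(n,\mathsf M_k^r) = (k - 1)(r - 1){n \choose r-1} + O(n^{r - 2}).\]
   Context: Let $\Omega_n$ be a set of $n$ points in strictly convex position in the plane with a fixed cyclic ordering $\prec$; for $u,v\in\Omega_n$, $[u,v]=\{w\in\Omega_n : u\prec w\prec v\}$ is a segment, and for sets $I_1,I_2,\dots\subset\Omega_n$ we write $I_1\prec I_2\prec\cdots$ if all vertices of $I_j$ are followed in $\prec$ by all vertices of $I_{j+1}$. An $r$-uniform convex geometric hypergraph (cgh) is an $r$-graph on vertex set $\Omega_n$, and for an $r$-uniform cgh $F$, $\mathrm{ex}_{\circlearrowright}(n,F)$ denotes the maximum number of edges in an $r$-uniform cgh on $\Omega_n$ not containing an ordered substructure isomorphic to $F$. For $k\ge 1$ and even $r\ge 2$, a $k$-zigzag $\mathsf P_k^r$ is a tight $k$-path $v_0v_1\dots v_{k+r-2}$ (edges $v_iv_{i+1}\dots v_{i+r-1}$, $0\le i<k$) with vertices in $\Omega_n$ such that there exist disjoint segments $I_0\prec I_1\prec\dots\prec I_{r-1}$ with $\{v_i : i\equiv j \pmod r\}\subseteq I_j$ for $0\le j<r$, and (i) if $j$ is even then $v_j\prec v_{j+r}\prec v_{j+2r}\prec\cdots$, (ii) if $j$ is odd then $v_j\succ v_{j+r}\succ v_{j+2r}\succ\cdots$. For $k\geq 1$ and even $r\geq 2$, a $k$-stack $\mathsf M_k^r$ is the cgh consisting of the edges $\{v_{ir},v_{ir+1},\dots,v_{ir+r-1}\}$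 for $0\le i<k$, where $v_0v_1\dots$ is an $r$-uniform zigzag path; i.e. every $r$th edge of a zigzag path $\mathsf P^r_{(k-1)r+1}$. *)

(* Defs.v *)
From mathcomp Require Import all_boot.
From mathcomp Require Import zify.

Set Implicit Arguments.
Unset Strict Implicit.
Unset Printing Implicit Defensive.

(* Omega_n is 'I_n, its points numbered in the fixed cyclic order; everything
   below depends on the numbering only up to rotation. *)

(* Number of steps from u to v in the direction of the cyclic order. *)
Definition cdist (n : nat) (u v : 'I_n) : nat := (v + n - u) %% n.

(* u, v, w are distinct and occur in this cyclic order. *)
Definition cyc3 (n : nat) (u v w : 'I_n) : bool := 0 < cdist u v < cdist u w.

(* Closed segment [u, v], possibly passing through the point n - 1 to 0. *)
Definition segment (n : nat) (u v : 'I_n) : {set 'I_n} :=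
  [set w | cdist u w <= cdist u v].

Definition cgh (n : nat) := {set {set 'I_n}}.

Definition uniform (n r : nat) (H : cgh n) : bool :=
  [forall e in H, #|e| == r].

(* H contains an ordered copy of F: f is an isomorphism of cyclically ordered
   hypergraphs from F (without its isolated points) onto a subhypergraph of
   H; the values of f outside the vertices covered by F are irrelevant. *)
Definition contains_copy (m n : nat) (F : cgh m) (H : cgh n) : bool :=
  [exists f : {ffun 'I_m -> 'I_n},
    [&& [forall u in cover F, forall v in cover F, (f u == f v) ==> (u == v)],
        [forall u in cover F, forall v in cover F, forall w in cover F,
           cyc3 u v w ==> cyc3 (f u) (f v) (f w)]
      & [forall e in F, f @: e \in H]]].

Definition ex_cgh (r n m : nat) (F : cgh m) : nat :=
  \max_(H : cgh n | uniform r H && ~~ contains_copy F H) #|H|.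

(* I_0, ..., I_(r-1), with I_j = [a j, b j], are disjoint segments met in this
   order when the circle is traversed once starting from a 0. *)
Definition segments_in_order (n r : nat) (a b : nat -> 'I_n) : Prop :=
  forall j l, j < l < r ->
    [disjoint segment (a j) (b j) & segment (a l) (b l)] /\
    (forall x y, x \in segment (a j) (b j) -> y \in segment (a l) (b l) ->
       cdist (a 0) x < cdist (a 0) y).

(* Only v 0, ..., v (k + r - 2) matter; inside the segment [a j, b j] the
   relation x before y reads cdist (a j) x < cdist (a j) y. *)
Definition is_zigzag (n k r : nat) (v : nat -> 'I_n) : Prop :=
  {in gtn (k + r - 1) &, injective v} /\
  exists a b : nat -> 'I_n,
    [/\ segments_in_order r a b,
        forall i, i < k + r - 1 -> v i \in segment (a (i %% r)) (b (i %% r)),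
        forall i, i + r < k + r - 1 -> ~~ odd (i %% r) ->
          cdist (a (i %% r)) (v i) < cdist (a (i %% r)) (v (i + r))
      & forall i, i + r < k + r - 1 -> odd (i %% r) ->
          cdist (a (i %% r)) (v (i + r)) < cdist (a (i %% r)) (v i)].

Definition path_edge (n r : nat) (v : nat -> 'I_n) (i : nat) : {set 'I_n} :=
  [set v (i + j) | j : 'I_r].

(* M is M_k^r: every r-th edge of a zigzag path P^r_((k-1)r+1). *)
Definition is_stack (n k r : nat) (M : cgh n) : Prop :=
  exists v : nat -> 'I_n,
    is_zigzag ((k - 1) * r + 1) r v /\
    M = [set path_edge r v (i * r) | i : 'I_k].

Lemma cdist_le (n : nat) (u v : 'I_n) : u <= v -> cdist u v = v - u.
Proof.
move=> uv; rewrite /cdist -addnBAC // modnDr modn_small //.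
by apply: leq_ltn_trans (ltn_ord v); apply: leq_subr.
Qed.

Lemma cdist_gt (n : nat) (u v : 'I_n) : v < u -> cdist u v = v + n - u.
Proof.
by move=> vu; rewrite /cdist modn_small //; have := ltn_ord u; lia.
Qed.

(* k-stacks exist, so quantifying over them is not vacuous. *)
Lemma stack_exists (k r : nat) : 0 < k -> 1 < r ->
  exists M : cgh (r * k), is_stack k r M.
Proof.
move=> k0 r1.
case nE: (r * k) => [|n']; first by have := muln_gt0 r k; rewrite nE k0; lia.
pose pos i := i %% r * k + (if odd (i %% r) then k.-1 - i %/ r else i %/ r).
pose v i : 'I_n'.+1 := inord (pos i).
pose a j : 'I_n'.+1 := inord (j * k).
pose b j : 'I_n'.+1 := inord (j * k + k.-1).
have NE : (k - 1) * r + 1 + r - 1 = k * r by nia.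
have divk i : i < k * r -> i %/ r < k by rewrite ltn_divLR //; lia.
have modr i : i %% r < r by rewrite ltn_mod; lia.
have posb i : i < k * r -> i %% r * k <= pos i <= i %% r * k + k.-1.
  move=> /divk; rewrite /pos; move: (i %% r) (i %/ r) => j q qk.
  by case: ifP => _; rewrite leq_addr leq_add2l; lia.
have bnd j : j < r -> j * k + k.-1 < n'.+1 by rewrite -nE; nia.
have aE j : j < r -> a j = j * k :> nat.
  by move=> /bnd h; rewrite inordK //; lia.
have bE j : j < r -> b j = j * k + k.-1 :> nat by move=> /bnd h; rewrite inordK.
have vE i : i < k * r -> v i = pos i :> nat.
  by move=> h; rewrite inordK //; have := posb i h; have := bnd _ (modr i); lia.
have segE j x : j < r ->
    (x \in segment (a j) (b j)) = (j * k <= x <= j * k + k.-1).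
  move=> jr; rewrite inE (@cdist_le _ (a j) (b j)) aE ?bE //; last by lia.
  have := bnd j jr; have := ltn_ord x.
  by case: (leqP (a j) x) => [/[dup]/cdist_le->|/[dup]/cdist_gt->]; rewrite aE //; lia.
exists [set path_edge r v (i * r) | i : 'I_k], v; split=> //.
rewrite /is_zigzag NE; split.
  move=> i i'; rewrite !inE => hi hi' /(congr1 (@nat_of_ord _)).
  rewrite !vE // => pE.
  have [p1 p2] := (posb i hi, posb i' hi').
  have mE : i %% r = i' %% r.
    by move: p1 p2 pE; move: (pos i) (pos i') (i %% r) (i' %% r); nia.
  have [d1 d2] := (divk i hi, divk i' hi').
  have dE : i %/ r = i' %/ r.
    move: pE; rewrite /pos mE => /addnI; move: d1 d2.
    by move: (i %/ r) (i' %/ r) => q q'; case: ifP; lia.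
  by rewrite (divn_eq i r) mE dE -divn_eq.
have a0 : a 0 = 0 :> nat by rewrite aE //; lia.
have dlt i : i + r < k * r -> (i + r) %/ r = (i %/ r).+1 /\ (i + r) %% r = i %% r.
  by move=> _; rewrite divnDr // divnn (ltnW r1) addn1 modnDr.
exists a, b; split.
- move=> j l /andP[jl lr]; have jr := ltn_trans jl lr; split.
    apply/pred0P => x /=; rewrite !segE //; nia.
  by move=> x y; rewrite !segE // !cdist_le a0 //; nia.
- by move=> i hi; rewrite segE // vE // posb.
- move=> i hi od; have [dE mE] := dlt i hi; have hi' : i < k * r by lia.
  have /andP[p1 _] := posb _ hi; have /andP[p2 _] := posb _ hi'.
  rewrite mE in p1; rewrite !cdist_le ?aE ?vE //.
  rewrite /pos mE dE (negbTE od); move: (i %% r * k) (i %/ r) => *; lia.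
- move=> i hi od; have [dE mE] := dlt i hi; have hi' : i < k * r by lia.
  have := divk _ hi; rewrite dE => dk.
  have /andP[p1 _] := posb _ hi; have /andP[p2 _] := posb _ hi'.
  rewrite mE in p1; rewrite !cdist_le ?aE ?vE //.
  rewrite /pos mE dE od; move: (i %% r * k) (i %/ r) dk => *; lia.
Qed.

(* Main.v *)
Require Import Defs.
From mathcomp Require Import all_boot all_order all_algebra.
From mathcomp Require Import zify.

(** Write K = k - 1.

    Upper bound: ex <= K (r-1) C(n, r-1). Label the vertices of each edge of H
    by 0, ..., r-1 in cyclic order, in all r possible ways. Step j deletes the
    labelled edges whose vertex j is extremal (first for even j, last for odd j)
    in its gap among the surviving labelled edges with the same other vertices;
    such an edge is determined by its other r-1 vertices and the label of one of
    them, so at most (r-1) C(n, r-1) labelled edges are lost. If r |H| exceeds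
    K r (r-1) C(n, r-1), some labelled edge survives K r steps j = 0, 1, 2, ...
    taken modulo r, and going back through the witnesses of its survival gives a
    zigzag path.

    Lower bound: cut the circle at 0 and take the r-sets y_0 < ... < y_(r-1) that
    meet {0, ..., K-1}, or have a pair of vertices at distance at most 2K, the
    first of odd and the second of even rank. In a k-stack the gaps of one colour
    (alternate gaps of an edge) shrink from edge to edge while those of the other
    colour grow. If an edge of the stack misses {0, ..., K-1}, so does the end of
    the stack where the gaps of the colour of the gap around 0 are widest; these
    gaps then have length more than 2K, so that last edge is not of the family.
    Hence all k disjoint edges meet a set of K points, a contradiction. *)

Set Implicit Arguments.
Unset Strict Implicit.
Unset Printing Implicit Defensive.

(** * Cyclic distance and cyclic order *)

Lemma cdistE n (u v : 'I_n) : cdist u v = if u <= v then v - u else v + n - u.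
Proof. by case: leqP => [/cdist_le|/cdist_gt]. Qed.

Lemma cdist_lt n (u v : 'I_n) : cdist u v < n.
Proof. by rewrite cdistE; have := ltn_ord u; have := ltn_ord v; case: (leqP u v); lia. Qed.

Lemma cdistxx n (u : 'I_n) : cdist u u = 0.
Proof. by rewrite cdistE leqnn subnn. Qed.

Lemma cdist_inj n (b : 'I_n) : injective (cdist b).
Proof.
move=> u v; rewrite !cdistE => uv; apply: val_inj => /=; move: uv.
by have := ltn_ord u; have := ltn_ord v; have := ltn_ord b;
  case: (leqP b u); case: (leqP b v); lia.
Qed.

(** Once the circle is opened at [b], cyclic order is linear order up to rotation; the base point
    can be chosen to suit the situation. *)
Lemma cyc3_cdist n (b u v w : 'I_n) :
  cyc3 u v w = [|| cdist b u < cdist b v < cdist b w,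
                   cdist b v < cdist b w < cdist b u
                 | cdist b w < cdist b u < cdist b v].
Proof.
rewrite /cyc3 !cdistE; have := ltn_ord u; have := ltn_ord v; have := ltn_ord w.
have := ltn_ord b.
case: (leqP u v); case: (leqP u w); case: (leqP b u); case: (leqP b v);
  case: (leqP b w); lia.
Qed.

Lemma cyc3_ord r (a b c : 'I_r) :
  cyc3 a b c = [|| a < b < c, b < c < a | c < a < b].
Proof.
case: r a b c => [[]//|r] a b c.
by rewrite (cyc3_cdist ord0) !cdistE /= !subn0.
Qed.

(** A walk from [o] meets the segment in one piece, from [a] onwards. This lets the order of a
    zigzag inside each of its segments be read from one common base point. *)
Lemma segment_cdist_lt n (o a b x y : 'I_n) :
  o = a \/ o \notin segment a b -> x \in segment a b -> y \in segment a b ->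
  cdist a x < cdist a y -> cdist o x < cdist o y.
Proof.
case=> [->//|]; rewrite !inE -ltnNge !cdistE.
have := ltn_ord x; have := ltn_ord y; have := ltn_ord a; have := ltn_ord b.
have := ltn_ord o.
case: (leqP a o); case: (leqP a b); case: (leqP a x); case: (leqP a y);
  case: (leqP o x); case: (leqP o y); lia.
Qed.

(** * Stacks as ordered arrays of vertices *)

(* Vertex v_(sr+j) of a zigzag is indexed by its edge s of the stack and its
   label j; this is the order in which the vertices are met on the circle. *)
Definition stack_lt (s j s' j' : nat) : bool :=
  (j < j') || ((j == j') && (if odd j then s' < s else s < s')).

Definition stack_ordered k r (q : nat -> nat -> nat) : Prop :=
  forall s j s' j', s < k -> s' < k -> j < r -> j' < r ->
    stack_lt s j s' j' -> q s j < q s' j'.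

Lemma stack_lt_total s j s' j' :
  [|| (s == s') && (j == j'), stack_lt s j s' j' | stack_lt s' j' s j].
Proof. by rewrite /stack_lt; have [||<-] := ltngtP j j'; rewrite ?orbT //; case: odd; lia. Qed.

Lemma stack_ordered_neq k r q s j s' j' : stack_ordered k r q ->
  s < k -> s' < k -> j < r -> j' < r -> q s j = q s' j' -> s = s' /\ j = j'.
Proof.
move=> qP sk s'k jr j'r qE; have /or3P[/andP[/eqP-> /eqP->]//||] := stack_lt_total s j s' j'.
  by move=> /(qP _ _ _ _ sk s'k jr j'r); rewrite qE ltnn.
by move=> /(qP _ _ _ _ s'k sk j'r jr); rewrite qE ltnn.
Qed.

Lemma stack_ordered_ltE k r q s j s' j' : stack_ordered k r q ->
  s < k -> s' < k -> j < r -> j' < r -> (q s j < q s' j') = stack_lt s j s' j'.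
Proof.
move=> qP sk s'k jr j'r; apply/idP/idP; last exact: qP.
have /or3P[/andP[/eqP-> /eqP->]|//|] := stack_lt_total s j s' j'; first by rewrite ltnn.
by move=> /(qP _ _ _ _ s'k sk j'r jr); lia.
Qed.

(** To compare entries of different rows, change row in column [j] or [j'] if one of them moves the
    right way. Otherwise [j] and [j'] have the same parity, and the column [j'.-1] or [j.+1] between
    them moves the right way. *)
Lemma stack_ordered_of_rows_cols k r q :
  (forall s j j', s < k -> j < j' -> j' < r -> q s j < q s j') ->
  (forall s s' j, s < s' -> s' < k -> j < r ->
     if odd j then q s' j < q s j else q s j < q s' j) ->
  stack_ordered k r q.
Proof.
move=> row col s j s' j' sk s'k jr j'r /orP[jj'|/andP[/eqP<-]]; last first.
  by case: ifP => oj lt; [have := col s' s j | have := col s s' j]; rewrite oj; apply.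
have [ss'|ss'|<-] := ltngtP s s'; last exact: row.
- have cj := col s s' j ss' s'k jr; have cj' := col s s' j' ss' s'k j'r.
  have rj := row s j j' sk jj' j'r; have rj' := row s' j j' s'k jj' j'r.
  case: (boolP (odd j)) cj => oj cj; last by lia.
  case: (boolP (odd j')) cj' => oj' cj'; last by lia.
  have c2 := col s s' j'.-1 ss' s'k; have r2 := row s j j'.-1 sk.
  have r3 := row s' j'.-1 j' s'k; rewrite (_ : odd j'.-1 = false) in c2; last by lia.
  have jj : j < j'.-1 by lia.
  by have := c2; have := r2; have := r3; lia.
- have cj := col s' s j ss' sk jr; have cj' := col s' s j' ss' sk j'r.
  have rj := row s j j' sk jj' j'r; have rj' := row s' j j' s'k jj' j'r.
  case: (boolP (odd j)) cj => oj cj; first by lia.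
  case: (boolP (odd j')) cj' => oj' cj'; first by lia.
  have c2 := col s' s j.+1 ss' sk; have r2 := row s j j.+1 sk.
  have r3 := row s' j.+1 j' s'k; rewrite (_ : odd j.+1 = true) in c2; last by lia.
  have jj : j.+1 < j' by lia.
  by have := c2; have := r2; have := r3; lia.
Qed.

Lemma index_lt k r s j : s < k -> j < r -> s * r + j < k * r.
Proof. by nia. Qed.

Lemma zigzag_stack_ordered m k r (v : nat -> 'I_m) : 0 < k -> 0 < r ->
  is_zigzag ((k - 1) * r + 1) r v ->
  exists b, stack_ordered k r (fun s j => cdist b (v (s * r + j))).
Proof.
move=> k0 r0 [_ [a [b]]].
rewrite (_ : (k - 1) * r + 1 + r - 1 = k * r); last by nia.
case=> seg vin ev od; exists (a 0).
have vseg s j : s < k -> j < r -> v (s * r + j) \in segment (a j) (b j).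
  by move=> sk jr; have := vin _ (index_lt sk jr); rewrite modnMDl modn_small.
(* The point [a 0] belongs to the first segment, hence by disjointness to no other, so it can serve
   as the common base point. *)
have a0 j : j < r -> a 0 = a j \/ a 0 \notin segment (a j) (b j).
  case: j => [|j] jr; [by left | right].
  have [+ _] := seg 0 j.+1 jr; move=> /pred0P/(_ (a 0)) /=.
  by rewrite {1}inE cdistxx /= => ->.
apply: stack_ordered_of_rows_cols.
  move=> s j j' sk jj' j'r.
  have [_ h] := seg j j' (introT andP (conj jj' j'r)).
  by apply: h; apply: vseg => //; apply: ltn_trans j'r.
have col1 s j : s.+1 < k -> j < r ->
    if odd j then cdist (a 0) (v (s.+1 * r + j)) < cdist (a 0) (v (s * r + j))
    else cdist (a 0) (v (s * r + j)) < cdist (a 0) (v (s.+1 * r + j)).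
  move=> sk jr; have h : s * r + j + r < k * r by have := index_lt sk jr; nia.
  have := ev _ h; have := od _ h; rewrite modnMDl modn_small //.
  rewrite (_ : s * r + j + r = s.+1 * r + j); last by nia.
  case: (boolP (odd j)) => oj h1 h2.
    apply: segment_cdist_lt (a0 _ jr) _ _ (h1 isT); apply: vseg => //; lia.
  apply: segment_cdist_lt (a0 _ jr) _ _ (h2 isT); apply: vseg => //; lia.
move=> s s' j; elim: s' => // s' IH; rewrite ltnS leq_eqVlt => /orP[/eqP->|ss'] s'k jr.
  exact: col1.
have := IH ss' (ltnW s'k) jr; have := col1 s' j s'k jr; case: odd; lia.
Qed.

Definition stack_edge n r (W : nat -> nat -> 'I_n) s : {set 'I_n} :=
  [set W s j | j : 'I_r].

(** This eliminates [M]: every k-stack has the same linear order on its pairs (s, j), so a copy of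
    it is any array [W] with that order from some base point. *)
Lemma contains_stackP k r m n (M : cgh m) (H : cgh n) : 0 < k -> 0 < r ->
  is_stack k r M ->
  contains_copy M H <->
  exists W b, stack_ordered k r (fun s j => cdist b (W s j)) /\
    forall s, s < k -> stack_edge r W s \in H.
Proof.
move=> k0 r0 [v [zz ->]].
have [c vP] := zigzag_stack_ordered k0 r0 zz.
have vM s j : s < k -> j < r ->
    v (s * r + j) \in cover [set path_edge r v (i * r) | i : 'I_k].
  move=> sk jr; apply/bigcupP; exists (path_edge r v (s * r)).
    by apply/imsetP; exists (Ordinal sk).
  by apply/imsetP; exists (Ordinal jr).
have Mv u : u \in cover [set path_edge r v (i * r) | i : 'I_k] ->
    exists s j, [/\ s < k, j < r & u = v (s * r + j)].
  case/bigcupP => e /imsetP[s _ ->] /imsetP[j _ ->].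
  by exists s, j; split=> //; apply: ltn_ord.
have vI s j s' j' : s < k -> s' < k -> j < r -> j' < r ->
    v (s * r + j) = v (s' * r + j') -> s = s' /\ j = j'.
  move=> sk s'k jr j'r vE.
  by apply: (stack_ordered_neq vP) => //; rewrite vE.
split.
  case/existsP=> f /and3P[/forallP finj /forallP fcyc /forallP fedge].
  have {}finj s j s' j' : s < k -> s' < k -> j < r -> j' < r ->
      f (v (s * r + j)) = f (v (s' * r + j')) -> s = s' /\ j = j'.
    move=> sk s'k jr j'r fE; apply: vI => //; apply/eqP.
    have /implyP/(_ (vM _ _ sk jr))/forallP/(_ (v (s' * r + j'))) := finj (v (s * r + j)).
    by move=> /implyP/(_ (vM _ _ s'k j'r))/implyP; apply; apply/eqP.
  (* With the image of [v 0] as base point, a triple [cyc3] starting at [v 0] becomes a comparison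
     of distances. The vertex [v 0] itself, at distance 0, is treated apart. *)
  exists (fun s j => f (v (s * r + j))), (f (v 0)); split; last first.
    move=> s sk.
    have /implyP := fedge (path_edge r v (s * r)).
    have -> : f @: path_edge r v (s * r) = stack_edge r (fun s j => f (v (s * r + j))) s.
      by rewrite /path_edge /stack_edge -imset_comp.
    by apply; apply/imsetP; exists (Ordinal sk).
  move=> s j s' j' sk s'k jr j'r lt.
  have [/andP[/eqP s0 /eqP j0]|ne] := boolP ((s == 0) && (j == 0)).
    subst; rewrite mul0n addn0 cdistxx lt0n; apply/eqP => fE.
    have {}fE : f (v (s' * r + j')) = f (v 0).
      by apply: (@cdist_inj _ (f (v 0))); rewrite fE cdistxx.
    have := @finj s' j' 0 0 s'k sk j'r jr.
    rewrite mul0n addn0 => /(_ fE)[s0 j0]; subst.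
    by move: lt; rewrite /stack_lt ltnn.
  have lt0 : stack_lt 0 0 s j by move: ne; rewrite /stack_lt /=; lia.
  have := fcyc (v 0); have v0 := vM _ _ k0 r0; rewrite mul0n addn0 in v0.
  rewrite v0 => /forallP/(_ (v (s * r + j))); rewrite vM //.
  move=> /forallP/(_ (v (s' * r + j'))); rewrite vM //= => /implyP.
  have -> : cyc3 (v 0) (v (s * r + j)) (v (s' * r + j')).
    rewrite (cyc3_cdist c); have := vP _ _ _ _ k0 sk r0 jr lt0.
    by have := vP _ _ _ _ sk s'k jr j'r lt; rewrite mul0n addn0 => -> ->.
  by move=> /(_ isT)/andP[].
case=> W [b [WP We]].
(* The value [b] is a dummy for points that are not vertices of the stack. *)
pose f : {ffun 'I_m -> 'I_n} := [ffun u : 'I_m => if [pick i : 'I_(k * r) | v i == u] is Some i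
  then W (i %/ r) (i %% r) else b].
have fE s j : s < k -> j < r -> f (v (s * r + j)) = W s j.
  move=> sk jr; rewrite ffunE; case: pickP => [i /eqP vi|/(_ (Ordinal (index_lt sk jr)))].
    have ik : i %/ r < k by rewrite ltn_divLR.
    have ir : i %% r < r by rewrite ltn_mod.
    have vE : v (i %/ r * r + i %% r) = v (s * r + j) by rewrite -divn_eq.
    by have [-> ->] := vI _ _ _ _ ik sk ir jr vE.
  by rewrite eqxx.
apply/existsP; exists f; apply/and3P; split.
- apply/forall_inP => u /Mv[s [j [sk jr ->]]]; apply/forall_inP => u' /Mv[s' [j' [s'k j'r ->]]].
  apply/implyP; rewrite !fE // => /eqP WE.
  have qE : cdist b (W s j) = cdist b (W s' j') by rewrite WE.
  by have [-> ->] := stack_ordered_neq WP sk s'k jr j'r qE.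
- apply/forall_inP => u /Mv[s [j [sk jr ->]]]; apply/forall_inP => u' /Mv[s' [j' [s'k j'r ->]]].
  apply/forall_inP => w /Mv[t [l [tk lr ->]]].
  rewrite !fE // (cyc3_cdist c) (cyc3_cdist b).
  have A x y x' y' : x < k -> x' < k -> y < r -> y' < r ->
      (cdist b (W x y) < cdist b (W x' y')) = (cdist c (v (x * r + y)) < cdist c (v (x' * r + y'))).
    by move=> *; rewrite (stack_ordered_ltE vP) // (stack_ordered_ltE WP).
  by rewrite !A // implybb.
- apply/forall_inP => e /imsetP[s _ ->].
  have -> : f @: path_edge r v (s * r) = stack_edge r W s.
    rewrite /path_edge /stack_edge -imset_comp; apply: eq_imset => j /=.
    by rewrite fE //.
  exact: We.
Qed.

(** * Upper bound: labelled edges *)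

Lemma card_sigma (T U : finType) (A : {set T}) (B : T -> {set U}) :
  #|[set p : T * U | (p.1 \in A) && (p.2 \in B p.1)]| = \sum_(x in A) #|B x|.
Proof.
transitivity (\sum_(x in A) \sum_(y in B x) 1); last by apply: eq_bigr => x _; rewrite sum1_card.
by rewrite pair_big_dep -sum1_card /=; apply: eq_bigl => p; rewrite inE.
Qed.

(** A labelled edge. Only the cyclic order is prescribed, so label 0 may fall on any vertex.
    Injectivity is required separately because [cyc3] says nothing about fewer than three points. *)
Definition cyclic_embedding r n (x : {ffun 'I_r -> 'I_n}) : bool :=
  injectiveb x && [forall a, forall b, forall c,
    cyc3 a b c ==> cyc3 (x a) (x b) (x c)].

Lemma cyclic_embeddingP r n (x : {ffun 'I_r -> 'I_n}) :
  reflect (injective x /\ forall a b c, cyc3 a b c -> cyc3 (x a) (x b) (x c))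
          (cyclic_embedding x).
Proof.
apply: (iffP andP) => -[/injectiveP xi h]; split=> //.
  move=> a b c; move: h => /forallP/(_ a)/forallP/(_ b)/forallP/(_ c)/implyP; exact.
by apply/forallP => a; apply/forallP => b; apply/forallP => c; apply/implyP/h.
Qed.

Lemma cyc3_asym n (u v w : 'I_n) : cyc3 u v w -> ~~ cyc3 u w v.
Proof. by rewrite /cyc3; lia. Qed.

Lemma cyc3_rot n (u v w : 'I_n) : cyc3 u v w = cyc3 v w u.
Proof. by rewrite !(cyc3_cdist u); lia. Qed.

Lemma cyc3_total n (u v w : 'I_n) : u != v -> u != w -> v != w ->
  cyc3 u v w || cyc3 u w v.
Proof.
move=> uv uw vw.
have d0 x : u != x -> 0 < cdist u x.
  apply: contraNT; rewrite -leqNgt leqn0 => /eqP ux.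
  by apply/eqP/(@cdist_inj _ u); rewrite cdistxx ux.
rewrite /cyc3 !d0 //=; case: (ltngtP (cdist u v)) => // /cdist_inj vw'.
by rewrite vw' eqxx in vw.
Qed.

Lemma cyclic_embedding_cyc3 r n (x : {ffun 'I_r -> 'I_n}) a b c :
  cyclic_embedding x -> cyc3 (x a) (x b) (x c) = cyc3 a b c.
Proof.
case/cyclic_embeddingP => xi xc; apply/idP/idP; last exact: xc.
move=> h; apply: contraTT (h) => nh.
have ne u v w : @cyc3 n u v w -> [/\ u != v, u != w & v != w].
  rewrite /cyc3 => /andP[h1 h2]; split; apply/eqP => E; subst; move: h1 h2;
  rewrite ?cdistxx ?ltnn; lia.
have [ab ac bc] := ne _ _ _ h.
have /orP[|/xc] : cyc3 a b c || cyc3 a c b.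
  by apply: cyc3_total; [move: ab | move: ac | move: bc]; apply: contraNneq => ->.
  by rewrite (negbTE nh).
exact: cyc3_asym.
Qed.

(** The vertices are listed in the order met from [u]. Letting [u] range over the edge gives one
    labelling per vertex, which multiplies the number of edges by the uniformity. *)
Lemma cyclic_embedding_exists r n (e : {set 'I_n}) (u : 'I_n) :
  #|e| = r.+1 -> u \in e ->
  exists x : {ffun 'I_r.+1 -> 'I_n},
    [/\ cyclic_embedding x, [set x i | i in 'I_r.+1] = e & x ord0 = u].
Proof.
move=> er ue; pose le a b := cdist u a <= cdist u b.
have let' : transitive le by move=> a b c; apply: leq_trans.
have leto : total le by move=> a b; apply: leq_total.
pose s := sort le (enum e).
have su : uniq s by rewrite sort_uniq enum_uniq.
have ss : size s = r.+1 by rewrite size_sort -cardE.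
have sm y : (y \in s) = (y \in e) by rewrite mem_sort mem_enum.
have sle : sorted le s by apply: sort_sorted.
pose x := [ffun i : 'I_r.+1 => nth u s i] : {ffun 'I_r.+1 -> 'I_n}.
have xi : injective x.
  move=> i j; rewrite !ffunE => /eqP; rewrite nth_uniq ?ss ?ltn_ord // => /eqP ij.
  exact: val_inj.
have xlt (i j : 'I_r.+1) : i < j -> cdist u (x i) < cdist u (x j).
  move=> ij; rewrite ltn_neqAle; apply/andP; split.
    by apply/eqP => /cdist_inj/xi E; rewrite E ltnn in ij.
  rewrite !ffunE; apply: (sorted_leq_nth let') => //; rewrite ?inE ?ss ?ltn_ord //.
    by move=> a; rewrite /le leqnn.
  exact: ltnW.
exists x; split.
- apply/cyclic_embeddingP; split=> // a b c; rewrite cyc3_ord (cyc3_cdist u).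
  by case/or3P => /andP[h1 h2]; rewrite (xlt _ _ h1) (xlt _ _ h2) ?orbT.
- apply/setP => y; rewrite -sm; apply/imsetP/idP.
    by case=> i _ ->; rewrite ffunE mem_nth // ss.
  move=> ys; have yl : index y s < r.+1 by rewrite -ss index_mem.
  by exists (Ordinal yl) => //; rewrite ffunE nth_index.
- apply: (@cdist_inj _ u); rewrite cdistxx; apply/eqP; rewrite -leqn0.
  have yl : index u s < r.+1 by rewrite -ss index_mem sm.
  have xu : x (Ordinal yl) = u by rewrite ffunE nth_index // sm.
  rewrite -(cdistxx u) -[X in _ <= cdist _ X]xu.
  case: (posnP (index u s)) => [i0|/(xlt ord0 (Ordinal yl))/ltnW//].
  by rewrite (_ : Ordinal yl = ord0) //; apply: val_inj.
Qed.

(* The rank of [x i] in the circle opened at [x i0] is determined by [i]. *)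
Lemma cyclic_embedding_eq_off r n (x y : {ffun 'I_r -> 'I_n}) (i0 j : 'I_r) :
  cyclic_embedding x -> cyclic_embedding y -> i0 != j -> x i0 = y i0 ->
  x @: [set~ j] = y @: [set~ j] -> forall i, i != j -> x i = y i.
Proof.
move=> cx cy i0j xy0 xyS i ij.
have [xi _] := cyclic_embeddingP _ cx; have [yi _] := cyclic_embeddingP _ cy.
have : x i \in y @: [set~ j] by rewrite -xyS imset_f // !inE.
case/imsetP => i'; rewrite !inE => i'j xiE.
suff ii' : i = i' by rewrite xiE ii'.
pose rk l := [set l' in [set~ j] | cyc3 i0 l' l].
have rkE (z : {ffun 'I_r -> 'I_n}) l : cyclic_embedding z ->
    #|rk l| = #|[set c in z @: [set~ j] | cyc3 (z i0) c (z l)]|.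
  move=> cz; have [zi _] := cyclic_embeddingP _ cz.
  rewrite -(card_imset (rk l) zi); apply: eq_card => c; rewrite !inE.
  apply/imsetP/andP.
    case=> l'; rewrite inE => /andP[l'j h] ->; rewrite imset_f //.
    by rewrite (cyclic_embedding_cyc3 _ _ _ cz).
  case=> /imsetP[l' l'j ->]; rewrite (cyclic_embedding_cyc3 _ _ _ cz) => h.
  by exists l' => //; rewrite inE l'j.
have : #|rk i| = #|rk i'| by rewrite (rkE x) // (rkE y) // xyS xy0 xiE.
have mono l l' : l != j -> cdist i0 l < cdist i0 l' -> l != i0 -> #|rk l| < #|rk l'|.
  move=> lj ll' l0; apply: proper_card; apply/properP; split.
    by apply/subsetP => c; rewrite !inE /cyc3 => /and3P[-> -> /=]; lia.
  exists l; rewrite !inE /cyc3 ?ltnn ?andbF // lj ll' andbT lt0n.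
  apply: contra l0 => /eqP d0; apply/eqP/(@cdist_inj _ i0).
  by rewrite d0 cdistxx.
(* Only labels strictly between are counted, so [i0] and the label after it both have rank 0; [mono]
   excludes [i0], which is handled here. *)
have [i_0|ii0] := eqVneq i i0.
  by move=> _; apply: yi; rewrite -xiE i_0 xy0.
have [i'_0|i'i0] := eqVneq i' i0.
  by move=> _; apply: xi; rewrite xiE i'_0 xy0.
move=> E; case: (ltngtP (cdist i0 i) (cdist i0 i')) => [||/cdist_inj//].
  by move=> /(mono _ _ ij)/(_ ii0); rewrite E ltnn.
by move=> /(mono _ _ i'j)/(_ i'i0); rewrite E ltnn.
Qed.

(** * Upper bound: deletion steps and zigzags *)

(* In a zigzag, labels 2i and 2i+1 move towards each other. *)
Definition partner r (j : 'I_r.+2) : 'I_r.+2 :=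
  inord (if odd j then j.-1 else j.+1).

(** A comparison on the circle needs a third point. The partner provides it even when edges have
    only two vertices: vertex [j] is farther from its partner in [y] than in [x]. *)
Definition coordinate_before r n (j : 'I_r.+2) (y x : {ffun 'I_r.+2 -> 'I_n}) : bool :=
  if odd j then cyc3 (x (partner j)) (x j) (y j)
  else cyc3 (y j) (x j) (x (partner j)).

Definition zigzag_step r n (j : 'I_r.+2) (y x : {ffun 'I_r.+2 -> 'I_n}) : bool :=
  [forall i, (i != j) ==> (y i == x i)] && coordinate_before j y x.

(** The survivors of a deletion step, [y] being the witness for [x]. *)
Definition step_image r n (j : 'I_r.+2) (L : {set {ffun 'I_r.+2 -> 'I_n}}) :=
  [set x in L | [exists y in L, zigzag_step j y x]].

Lemma partner_val r (j : 'I_r.+2) : ~~ odd r ->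
  partner j = (if odd j then j.-1 else j.+1) :> nat.
Proof.
by move=> re; rewrite inordK //; have := ltn_ord j; case: (boolP (odd j)); lia.
Qed.

Lemma partner_neq r (j : 'I_r.+2) : ~~ odd r -> partner j != j.
Proof.
move=> re; apply/eqP => /(congr1 (@nat_of_ord _)); rewrite partner_val //.
by case: (boolP (odd j)); lia.
Qed.

(** A deleted labelled edge is encoded by the set of its vertices other than [j] and by its vertex
    [partner j]. Two deleted edges with the same code agree off [j]; if they differed at [j], one
    would come before the other and be a witness for its survival. *)
Lemma card_step_image r n (j : 'I_r.+2) (L : {set {ffun 'I_r.+2 -> 'I_n}}) :
  ~~ odd r -> {in L, forall x, cyclic_embedding x} ->
  #|L| <= #|step_image j L| + r.+1 * 'C(n, r.+1).
Proof.
move=> re Lc; rewrite -(cardsID (step_image j L) L).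
apply: leq_add; first by apply: subset_leq_card; apply: subsetIr.
pose F (x : {ffun 'I_r.+2 -> 'I_n}) := (x @: [set~ j] : {set 'I_n}, x (partner j) : 'I_n).
have <- : #|[set p : {set 'I_n} * 'I_n |
    (p.1 \in [set S : {set 'I_n} | #|S| == r.+1]) && (p.2 \in p.1)]| = r.+1 * 'C(n, r.+1).
  rewrite (card_sigma [set S : {set 'I_n} | #|S| == r.+1] id).
  transitivity (\sum_(S in [set S : {set 'I_n} | #|S| == r.+1]) r.+1).
    by apply: eq_bigr => S; rewrite inE => /eqP.
  by rewrite sum_nat_const card_draws card_ord mulnC.
have pj := partner_neq j re.
rewrite -(card_in_imset (f := F) (D := L :\: step_image j L)); last first.
  move=> x y; rewrite !inE => /andP[xn xL] /andP[yn yL] [SE wE].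
  have cx := Lc _ xL; have cy := Lc _ yL.
  have off := cyclic_embedding_eq_off cx cy pj wE SE.
  have [xi _] := cyclic_embeddingP _ cx; have [yi _] := cyclic_embeddingP _ cy.
  have xyj : x j = y j.
    apply/eqP; apply: contraNT xn => xyj; rewrite xL /=.
    have xp : x (partner j) != x j by apply: contra pj => /eqP/xi->.
    have yp : x (partner j) != y j by rewrite wE; apply: contra pj => /eqP/yi->.
    have [yx|] := boolP (coordinate_before j y x).
      apply/existsP; exists y; rewrite yL /=; apply/andP; split=> //.
      by apply/forall_inP => i ij; rewrite off.
    move=> nyx; have xy : coordinate_before j x y.
      move: nyx (cyc3_total xp yp xyj); rewrite /coordinate_before.
      case: ifP => _; first by rewrite wE => /negbTE->.
      by rewrite -wE -!(cyc3_rot (x (partner j))) => /negbTE->; rewrite orbF.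
    case/negP: yn; rewrite yL /=; apply/existsP; exists x; rewrite xL /=.
    apply/andP; split=> //.
    by apply/forall_inP => i ij; rewrite off.
  by apply/ffunP => i; have [->|/off] := eqVneq i j.
apply: subset_leq_card; apply/subsetP => p /imsetP[x /setDP[xL _] ->].
have [xi _] := cyclic_embeddingP _ (Lc _ xL).
by rewrite !inE /= card_imset // cardsC1 card_ord eqxx /= imset_f // !inE.
Qed.

Fixpoint step_images r n (L : {set {ffun 'I_r.+2 -> 'I_n}}) (t : nat) :=
  if t is t'.+1 then step_image (inord (t' %% r.+2)) (step_images L t') else L.

Lemma step_images_sub r n (L : {set {ffun 'I_r.+2 -> 'I_n}}) t :
  step_images L t \subset L.
Proof.
elim: t => //= t IH; apply: subset_trans IH.
by apply/subsetP => x; rewrite inE => /andP[].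
Qed.

Lemma card_step_images r n (L : {set {ffun 'I_r.+2 -> 'I_n}}) t :
  ~~ odd r -> {in L, forall x, cyclic_embedding x} ->
  #|L| <= #|step_images L t| + t * (r.+1 * 'C(n, r.+1)).
Proof.
move=> re Lc; elim: t => [|t IH] /=; first by rewrite addn0.
apply: leq_trans IH _; rewrite mulSn addnA leq_add2r; apply: card_step_image => //.
by move=> x /(subsetP (step_images_sub L t)); apply: Lc.
Qed.

(** The witness for a survivor of [t.+1] steps has itself survived [t] steps, so witnesses can be
    followed back to [L]. *)
Lemma step_images_trace r n (L : {set {ffun 'I_r.+2 -> 'I_n}}) t x :
  x \in step_images L t ->
  exists X : nat -> {ffun 'I_r.+2 -> 'I_n},
    [/\ X t = x, forall s, s <= t -> X s \in L
      & forall s, s < t -> zigzag_step (inord (s %% r.+2)) (X s) (X s.+1)].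
Proof.
elim: t x => [|t IH] x /= xL.
  by exists (fun=> x); split=> // s _.
move: xL; rewrite inE => /andP[xt /exists_inP[y /IH[X [Xt XL Xs]] yx]].
exists (fun s => if s <= t then X s else x); split.
- by rewrite ltnn.
- move=> s _; case: ifP => [|_]; first exact: XL.
  exact: (subsetP (step_images_sub L t)).
- move=> s; rewrite ltnS => st; rewrite st; case: ltnP => [|ts]; first exact: Xs.
  by have -> : s = t; [apply/eqP; rewrite eqn_leq st ts | rewrite Xt].
Qed.

(** Vertex [j] moves towards its partner, which carries an adjacent label, without reaching it.
    Hence it passes no other vertex and does not cross [b]. *)
Lemma zigzag_step_increasing r n (b : 'I_n) (j : 'I_r.+2)
    (y x : {ffun 'I_r.+2 -> 'I_n}) : ~~ odd r ->
  (forall a c : 'I_r.+2, a < c -> cdist b (y a) < cdist b (y c)) ->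
  zigzag_step j y x ->
  (forall a c : 'I_r.+2, a < c -> cdist b (x a) < cdist b (x c)) /\
  (if odd j then cdist b (x j) < cdist b (y j)
   else cdist b (y j) < cdist b (x j)).
Proof.
move=> re yinc /andP[/forall_inP off bef].
have {}off i : i != j -> x i = y i by move=> /off/eqP.
have xp : x (partner j) = y (partner j) by rewrite off ?partner_neq.
have pv := partner_val j re.
have jlt := ltn_ord j.
have key : if odd j then cdist b (y (partner j)) < cdist b (x j) < cdist b (y j)
           else cdist b (y j) < cdist b (x j) < cdist b (y (partner j)).
  move: bef; rewrite /coordinate_before xp; case: (boolP (odd j)) pv => oj pv;
  rewrite (cyc3_cdist b).
    by have := yinc (partner j) j; rewrite pv; lia.
  by have := yinc j (partner j); rewrite pv; lia.
split; last by case: odd key; lia.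
have yle (a c : 'I_r.+2) : a <= c -> cdist b (y a) <= cdist b (y c).
  rewrite leq_eqVlt => /orP[/eqP/val_inj->//|/yinc]; exact: ltnW.
move=> a c ac; have [aj|aj] := eqVneq a j; have [cj|cj] := eqVneq c j.
- by rewrite aj cj ltnn in ac.
- rewrite aj (off c) //; rewrite aj in ac.
  case: (boolP (odd j)) key pv => oj key pv; first by have := yinc _ _ ac; lia.
  by have := yle (partner j) c; rewrite pv; lia.
- rewrite cj (off a) //; rewrite cj in ac.
  case: (boolP (odd j)) key pv => oj key pv; last by have := yinc _ _ ac; lia.
  by have := yle a (partner j); rewrite pv; lia.
- by rewrite !off //; apply: yinc.
Qed.

(** In a round of [r.+2] steps each vertex moves exactly once, vertex [j] at step [j]. Sampling once
    per round therefore gives rows that increase from [b] and columns that move in the direction set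
    by the parity of [j]. *)
Lemma zigzag_steps_stack_ordered r n k (X : nat -> {ffun 'I_r.+2 -> 'I_n}) :
  ~~ odd r -> cyclic_embedding (X 0) ->
  (forall s, s < k * r.+2 -> zigzag_step (inord (s %% r.+2)) (X s) (X s.+1)) ->
  stack_ordered k.+1 r.+2
    (fun s j => cdist (X 0 ord0) (X (s * r.+2) (inord j))).
Proof.
move=> re /cyclic_embeddingP[xi xc] Xs; set b := X 0 ord0.
have inc t : t <= k * r.+2 ->
    forall a c : 'I_r.+2, a < c -> cdist b (X t a) < cdist b (X t c).
  elim: t => [_ a c ac|t IH tk].
    have [a0|a0] := posnP a.
      have -> : a = ord0 by apply: val_inj.
      rewrite /b cdistxx lt0n; apply/eqP => d0.
      have /xi ca : X 0 c = X 0 ord0 by apply: (@cdist_inj _ b); rewrite d0 cdistxx.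
      by rewrite ca in ac.
    have : cyc3 ord0 a c by rewrite cyc3_ord a0 ac.
    by move=> /xc/andP[].
  by have [] := zigzag_step_increasing re (IH (ltnW tk)) (Xs _ tk).
have one s (j : 'I_r.+2) : s < k ->
    if odd j then cdist b (X (s.+1 * r.+2) j) < cdist b (X (s * r.+2) j)
    else cdist b (X (s * r.+2) j) < cdist b (X (s.+1 * r.+2) j).
  move=> sk.
  have tk i : i < r.+2 -> s * r.+2 + i < k * r.+2 by move=> ir; exact: index_lt.
  have st i (ir : i < r.+2) : zigzag_step (Ordinal ir) (X (s * r.+2 + i)) (X (s * r.+2 + i.+1)).
    have := Xs _ (tk _ ir); rewrite addnS modnMDl modn_small //.
    by rewrite (_ : inord i = Ordinal ir) //; apply: val_inj; rewrite /= inordK.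
  have same i : i < r.+2 -> i != j -> X (s * r.+2 + i.+1) j = X (s * r.+2 + i) j.
    move=> ir ij; have /andP[/forall_inP/(_ j) + _] := st _ ir.
    by rewrite -val_eqE /= eq_sym => /(_ ij)/eqP.
  have lo i : i <= j -> X (s * r.+2 + i) j = X (s * r.+2) j.
    elim: i => [|i IH] ij; first by rewrite addn0.
    by rewrite same ?IH //; have := ltn_ord j; lia.
  have hi i : j < i -> i <= r.+2 -> X (s * r.+2 + i) j = X (s * r.+2 + j.+1) j.
    elim: i => // i IH; rewrite ltnS leq_eqVlt => /orP[/eqP->//|ji] ir.
    by rewrite same ?IH //; lia.
  have [_] := zigzag_step_increasing re (inc _ (ltnW (tk _ (ltn_ord j)))) (st _ (ltn_ord j)).
  rewrite (_ : Ordinal _ = j); last exact: val_inj.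
  rewrite /= (lo j) // -(hi r.+2) // (_ : s * r.+2 + r.+2 = s.+1 * r.+2) //.
  by rewrite mulSn addnC.
apply: stack_ordered_of_rows_cols.
  move=> s j j' sk jj' j'r; apply: inc; first by nia.
  by rewrite !inordK //; lia.
move=> s s' j ss' s'k jr; have jE : (inord j : 'I_r.+2) = j :> nat by rewrite inordK.
elim: s' ss' s'k => // s' IH; rewrite ltnS leq_eqVlt => /orP[/eqP->|ss'] s'k.
  by have := one s' (inord j) s'k; rewrite jE.
have := IH ss' (ltnW s'k); have := one s' (inord j) s'k; rewrite jE.
by case: odd; lia.
Qed.

Lemma stack_of_many_edges r n k (H : cgh n) : ~~ odd r -> uniform r.+2 H ->
  k * r.+1 * 'C(n, r.+1) < #|H| ->
  exists W b, stack_ordered k.+1 r.+2 (fun s j => cdist b (W s j)) /\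
    forall s, s < k.+1 -> stack_edge r.+2 W s \in H.
Proof.
move=> re /forall_inP Hu Hbig.
pose L := [set x : {ffun 'I_r.+2 -> 'I_n} |
  cyclic_embedding x && ([set x i | i in 'I_r.+2] \in H)].
have Lc : {in L, forall x, cyclic_embedding x} by move=> x; rewrite inE => /andP[].
have cardL : r.+2 * #|H| <= #|L|.
  rewrite mulnC -sum_nat_const.
  rewrite (eq_bigr (fun e : {set 'I_n} => #|e|)); last by move=> e /Hu/eqP.
  rewrite -(card_sigma H id).
  pose G (x : {ffun 'I_r.+2 -> 'I_n}) := ([set x i | i in 'I_r.+2], x ord0).
  apply: leq_trans (leq_imset_card G L); apply: subset_leq_card.
  apply/subsetP => -[e u]; rewrite inE /= => /andP[eH ue].
  have [x [cx xe xu]] := cyclic_embedding_exists (eqP (Hu _ eH)) ue.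
  by apply/imsetP; exists x; rewrite ?inE ?cx /G xe // xu.
(* Here [k] is the K of the overview and [r.+2] the uniformity: the [k * r.+2] steps lose at most
   [k * r.+2 * r.+1 * 'C(n, r.+1)] labelled edges, fewer than [r.+2 * #|H|]. *)
have /card_gt0P[x xL] : 0 < #|step_images L (k * r.+2)|.
  have := card_step_images (k * r.+2) re Lc; move: Hbig cardL.
  by move: #|_| #|_| #|_| 'C(_, _) => *; nia.
have [X [_ XL Xs]] := step_images_trace xL.
exists (fun s j => X (s * r.+2) (inord j)), (X 0 ord0); split.
  by apply: zigzag_steps_stack_ordered => //; apply/Lc/XL.
move=> s sk; have : X (s * r.+2) \in L by apply: XL; nia.
rewrite inE => /andP[_]; congr (_ \in H); apply: eq_imset => j.
by rewrite inord_val.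
Qed.

(** * Lower bound: ranks and gaps in an ordered stack *)

Definition rank n (e : {set 'I_n}) (x : nat) : nat := #|[set c in e | c < x]|.

Definition crank n (b : 'I_n) (e : {set 'I_n}) (x : 'I_n) : nat :=
  #|[set c in e | cdist b c < cdist b x]|.

Lemma card_setid_sum (T : finType) (e : {set T}) (Q : pred T) :
  #|[set c in e | Q c]| = \sum_(c in e) Q c.
Proof.
rewrite -sum1_card big_mkcond [RHS]big_mkcond; apply: eq_bigr => c _.
by rewrite !inE; case: (c \in e); case: (Q c).
Qed.

(** Moving the cut from [b] to 0 shifts all ranks by the same amount modulo [#|e|]. As [#|e|] is
    even, parities all change alike, so the two colours of gaps do not depend on the cut. *)
Lemma odd_rank n (b z : 'I_n) (e : {set 'I_n}) (x : 'I_n) :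
  ~~ odd #|e| -> z = 0 :> nat ->
  odd (rank e x) = odd (crank b e x) (+) odd (crank b e z).
Proof.
move=> ee z0; rewrite /rank /crank !card_setid_sum -oddD.
have [zx|xz] := leqP (cdist b z) (cdist b x).
  have -> : \sum_(c in e) (cdist b c < cdist b x) =
      \sum_(c in e) (c < x) + \sum_(c in e) (cdist b c < cdist b z).
    rewrite -big_split; apply: eq_bigr => c _ /=; move: zx; rewrite !cdistE z0.
    have := ltn_ord c; have := ltn_ord x; have := ltn_ord b.
    by case: (leqP b c); case: (leqP b x); case: (leqP b 0); lia.
  by rewrite -addnA addnn oddD odd_double addbF.
have : \sum_(c in e) (c < x) + \sum_(c in e) (cdist b c < cdist b z) =
    #|e| + \sum_(c in e) (cdist b c < cdist b x).
  rewrite -sum1_card -!big_split; apply: eq_bigr => c _ /=; move: xz; rewrite !cdistE z0.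
  have := ltn_ord c; have := ltn_ord x; have := ltn_ord b.
  by case: (leqP b c); case: (leqP b x); case: (leqP b 0); lia.
move: (\sum_(c in e) (c < x)) (\sum_(c in e) (cdist b c < cdist b z)) => p q.
by move: (\sum_(c in e) _) => w; lia.
Qed.

Lemma cdist_rebase n (b u v : 'I_n) :
  cdist u v = if cdist b u <= cdist b v then cdist b v - cdist b u
              else cdist b v + n - cdist b u.
Proof.
rewrite !cdistE; have := ltn_ord b; have := ltn_ord u; have := ltn_ord v.
by case: (leqP b u); case: (leqP b v); case: (leqP u v); case: ifP; lia.
Qed.

Lemma downward_closed_threshold (A : pred nat) r :
  (forall i j, i < j -> j < r -> A j -> A i) ->
  exists2 m, m <= r & forall j, j < r -> A j = (j < m).
Proof.
elim: r => [|r IH] dc; first by exists 0.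
have [|m mr mP] := IH; first by move=> i j ij jr; apply: dc => //; apply: ltnW.
have [Ar|nAr] := boolP (A r).
  exists r.+1 => // j jr; rewrite jr; move: jr; rewrite ltnS leq_eqVlt.
  by case/orP => [/eqP->//|jr]; apply: dc Ar.
exists m => [|j]; first exact: leqW.
rewrite ltnS leq_eqVlt => /orP[/eqP->|]; last exact: mP.
by rewrite (negbTE nAr) ltnNge mr.
Qed.

Lemma card_ord_lt r m : m <= r -> #|[set j : 'I_r | j < m]| = m.
Proof.
move=> mr; rewrite -sum1_card (eq_bigl (fun j : 'I_r => j < m)); last by move=> j; rewrite inE.
by rewrite -(big_ord_widen _ (fun=> 1)) // sum1_card card_ord.
Qed.

Section OrderedStack.
Variables (n k r : nat) (W : nat -> nat -> 'I_n) (b : 'I_n).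
Hypothesis WP : stack_ordered k r (fun s j => cdist b (W s j)).

Lemma stack_vertex_inj s j s' j' : s < k -> s' < k -> j < r -> j' < r ->
  W s j = W s' j' -> s = s' /\ j = j'.
Proof. by move=> sk s'k jr j'r WE; apply: (stack_ordered_neq WP) => //; rewrite WE. Qed.

Lemma card_stack_edge s : s < k -> #|stack_edge r W s| = r.
Proof.
move=> sk; rewrite card_imset ?card_ord // => i j WE; apply: val_inj.
by have [] := stack_vertex_inj sk sk (ltn_ord i) (ltn_ord j) WE.
Qed.

Lemma row_ltE s j j' : s < k -> j < r -> j' < r ->
  (cdist b (W s j) < cdist b (W s j')) = (j < j').
Proof.
move=> sk jr j'r; rewrite (stack_ordered_ltE WP) // /stack_lt ltnn.
by rewrite if_same andbF orbF.
Qed.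

Lemma crank_threshold s x m : s < k -> m <= r ->
  (forall j, j < r -> (cdist b (W s j) < cdist b x) = (j < m)) ->
  crank b (stack_edge r W s) x = m.
Proof.
move=> sk mr mP; rewrite -[RHS](card_ord_lt mr) /crank.
have Wi : injective (fun j : 'I_r => W s j).
  by move=> i j WE; apply: val_inj; have [] := stack_vertex_inj sk sk (ltn_ord i) (ltn_ord j) WE.
rewrite -(card_imset [set j : 'I_r | j < m] Wi); apply: eq_card => c.
rewrite inE; apply/andP/imsetP.
  by case=> /imsetP[j _ ->]; rewrite mP // => jm; exists j; rewrite ?inE.
by case=> j; rewrite inE => jm ->; rewrite mP // jm imset_f.
Qed.

Lemma crankP s x j : s < k -> j < r ->
  (cdist b (W s j) < cdist b x) = (j < crank b (stack_edge r W s) x).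
Proof.
move=> sk jr.
have [i i' ii' i'r /=|m mr mP] := @downward_closed_threshold
    (fun j => cdist b (W s j) < cdist b x) r.
  apply: ltn_trans; rewrite row_ltE //; exact: ltn_trans i'r.
by rewrite (crank_threshold sk mr mP) mP.
Qed.

Lemma crank_vertex s j : s < k -> j < r -> crank b (stack_edge r W s) (W s j) = j.
Proof.
move=> sk jr; apply: crank_threshold (ltnW jr) _ => // i ir; exact: row_ltE.
Qed.

Lemma crank_le s x : s < k -> crank b (stack_edge r W s) x <= r.
Proof.
move=> sk; rewrite -[leqRHS](card_stack_edge sk).
by apply: subset_leq_card; apply/subsetP => c; rewrite inE => /andP[].
Qed.

(* If the gaps of edge s of the colour of the gap containing x widen from s to
   s', then x stays in that gap. *)
Lemma crank_widening s s' x : s < k -> s' < k -> x \notin stack_edge r W s ->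
  (forall j, j < r -> if odd j == odd (crank b (stack_edge r W s) x)
     then cdist b (W s j) <= cdist b (W s' j)
     else cdist b (W s' j) <= cdist b (W s j)) ->
  x \notin stack_edge r W s' /\
  crank b (stack_edge r W s') x = crank b (stack_edge r W s) x.
Proof.
move=> sk s'k xs; set m := crank b (stack_edge r W s) x => mono.
have mr : m <= r by apply: crank_le.
have lo j : j < m -> cdist b (W s' j) < cdist b x.
  move=> jm; have jr := leq_trans jm mr.
  have below i : i < m -> odd i != odd m -> cdist b (W s' i) < cdist b x.
    move=> im om; have ir := leq_trans im mr; have := mono _ ir.
    rewrite (negbTE om) => h; apply: leq_ltn_trans h _.
    by rewrite crankP.
  (* A label below [m] with the parity of [m] may move towards [x], but it is held back by the next
     label, still below [m] and of the other parity. The same holds in mirror image in [hi]. *)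
  have [om|/below] := eqVneq (odd j) (odd m); last exact.
  have jm' : j.+1 < m by lia.
  have h : cdist b (W s' j.+1) < cdist b x by apply: below => //=; rewrite om; case: odd.
  apply: ltn_trans h.
  by rewrite row_ltE // (leq_trans jm').
have hi j : m <= j -> j < r -> cdist b x < cdist b (W s' j).
  have above i : m <= i -> i < r -> odd i = odd m -> cdist b x < cdist b (W s' i).
    move=> mi ir om; have := mono _ ir; rewrite om eqxx => h.
    apply: leq_trans h; rewrite ltn_neqAle leqNgt crankP // -/m ltnNge mi andbT.
    apply: contra xs => /eqP/cdist_inj ->; exact: (imset_f _ (x := Ordinal ir)).
  move=> mj jr; have [om|om] := eqVneq (odd j) (odd m); first exact: above.
  have mj' : m <= j.-1 by lia.
  have jr' : j.-1 < r by lia.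
  have h := above _ mj' jr'; apply: ltn_trans (h _) _; first by lia.
  by rewrite row_ltE //; lia.
split.
  apply/negP => /imsetP[j _ xE]; have [jm|mj] := ltnP j m.
    by have := lo _ jm; rewrite xE ltnn.
  by have := hi _ mj (ltn_ord j); rewrite xE ltnn.
apply: crank_threshold => // j jr; case: (ltnP j m) => [/lo//|mj].
by apply/negbTE; rewrite -leqNgt ltnW // hi.
Qed.

Lemma column_growth s s' j : s <= s' -> s' < k -> j < r ->
  if odd j then cdist b (W s' j) + (s' - s) <= cdist b (W s j)
  else cdist b (W s j) + (s' - s) <= cdist b (W s' j).
Proof.
move=> ss' s'k jr; elim: s' ss' s'k => [|s' IH].
  by rewrite leqn0 => /eqP-> _; case: odd; rewrite addn0.
rewrite leq_eqVlt => /orP[/eqP-> _|]; first by rewrite subnn addn0; case: odd.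
rewrite ltnS => ss' s'k; have := IH ss' (ltnW s'k).
have := @WP s' j s'.+1 j; have := @WP s'.+1 j s' j; rewrite /stack_lt eqxx ltnn /=.
by case: odd => h1 h2; lia.
Qed.

(** From edge [s] to edge [s'] both ends of the arc from label [j] to label [j'] move inwards by at
    least [d], and the arc keeps positive length. The arc may pass through [b], when [j' < j]. *)
Lemma vertices_far s s' j j' d : s < k -> s' < k -> j < r -> j' < r -> j != j' ->
  cdist b (W s j) + d <= cdist b (W s' j) ->
  cdist b (W s' j') + d <= cdist b (W s j') ->
  d.*2 < cdist (W s j) (W s j').
Proof.
move=> sk s'k jr j'r jj' h h'.
have := cdist_lt b (W s' j); have := cdist_lt b (W s j); have := cdist_lt b (W s' j').
have := row_ltE s'k jr j'r; have := row_ltE sk jr j'r; have := row_ltE sk j'r jr.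
rewrite (cdist_rebase b (W s j)).
by case: (ltngtP j j') jj' => // jj' _; case: ifP; lia.
Qed.

End OrderedStack.

(** * Lower bound: the construction contains no stack *)

(* Every (r-1)-set acquires edges of two kinds: one for each of the K points at
   the cut, and 2K for each of its r/2 - 1 elements of odd rank (ranks start
   from 0). *)
Definition lower_cgh n r K : cgh n :=
  [set e : {set 'I_n} | (#|e| == r) &&
    ([exists z in e, z < K] ||
     [exists a in e, exists c in e,
        [&& a < c <= a + K.*2, odd (rank e a) & ~~ odd (rank e c)]])].

Lemma rank_initial n (e : {set 'I_n}) K x : (forall z, z \in e -> K <= z) ->
  x < K -> rank e x = 0.
Proof.
move=> eK xK; apply: eq_card0 => c; rewrite !inE; apply/negP => /andP[/eK]; lia.
Qed.

Lemma lower_cgh_stack_free n r k (W : nat -> nat -> 'I_n) b :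
  ~~ odd r -> 0 < k -> stack_ordered k r (fun s j => cdist b (W s j)) ->
  ~ (forall s, s < k -> stack_edge r W s \in lower_cgh n r k.-1).
Proof.
move=> re k0 WP WH.
pose z : 'I_n := Ordinal (leq_ltn_trans (leq0n b) (ltn_ord b)).
have kK : k.-1 < k by rewrite prednK.
have ecard s : s < k -> ~~ odd #|stack_edge r W s| by move=> sk; rewrite (card_stack_edge WP).
(* s' is the edge of the stack whose gaps of the colour of the cut are widest *)
have contra s s' m : s < k -> s' < k -> 0 < k.-1 ->
    (forall x, x \in stack_edge r W s -> k.-1 <= x) ->
    odd (crank b (stack_edge r W s) z) = m ->
    (forall j, j < r -> if odd j == m
       then cdist b (W s j) <= cdist b (W s' j)
       else cdist b (W s' j) <= cdist b (W s j)) ->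
    (forall j j', j < r -> j' < r -> odd j != m -> odd j' == m ->
       (k.-1).*2 < cdist (W s' j) (W s' j')) -> False.
  move=> sk s'k K0 miss zm mono far.
  (* Edge [s] has no vertex before [x], so [x] and [z] lie in gaps of the same colour; widening
     these gaps keeps [x] off edge [s']. *)
  have cut (x : 'I_n) : x < k.-1 -> x \notin stack_edge r W s' /\
      odd (crank b (stack_edge r W s') x) = m.
    move=> xK; have xs : x \notin stack_edge r W s by apply/negP => /miss; lia.
    have xm : odd (crank b (stack_edge r W s) x) = m.
      have := odd_rank b x (ecard _ sk) (erefl : z = 0 :> nat).
      by rewrite (rank_initial miss xK) zm /=; case: odd; case: m {zm mono far}.
    by have [|? ->] := crank_widening WP sk s'k xs; rewrite ?xm.
  have [_ zm'] := cut z K0.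
  have : stack_edge r W s' \in lower_cgh n r k.-1 by apply: WH.
  rewrite inE (card_stack_edge WP) // eqxx /= => /orP[/exists_inP[x xs' xK]|].
    by have [] := cut x xK; rewrite xs'.
  (* Edge [s'] must then have a close pair. Relative to [m], ranks of odd and even parity become
     labels of parity other than [m] and equal to [m], so [far] applies. *)
  case/exists_inP => _ /imsetP[j _ ->] /exists_inP[_ /imsetP[j' _ ->]].
  rewrite !(odd_rank b _ (ecard _ s'k) (erefl : z = 0 :> nat)) zm'.
  rewrite !(crank_vertex WP) // => /and3P[lt oj oj'].
  have oj1 : odd j != m by move: oj; case: odd; case: (m).
  have oj2 : odd j' == m by move: oj'; case: odd; case: (m).
  have := far j j' (ltn_ord j) (ltn_ord j') oj1 oj2.
  by rewrite cdist_le; lia.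
have hit s : s < k -> exists2 x, x \in stack_edge r W s & x < k.-1.
  (* For K = 0 the family is empty. *)
  move=> sk; case: (posnP k.-1) => [K0|K0].
    have := WH s sk; rewrite K0 inE => /andP[_ /orP[/exists_inP[x]//|]].
    case/exists_inP => a _ /exists_inP[c _]; lia.
  apply/exists_inP; apply: contraT => /exists_inPn nhit; exfalso.
  have miss x : x \in stack_edge r W s -> k.-1 <= x by move=> /nhit; rewrite -leqNgt.
  have ne (m : bool) (j j' : nat) : odd j != m -> odd j' == m -> j != j'.
    by move=> h1 h2; apply: contraNneq h1 => ->.
  (* The gap of rank m ends at label m. Odd labels move backwards along the stack and even labels
     forwards, so gaps ending at odd labels are widest in edge 0 and the others in edge [k.-1]. *)
  case zm: (odd (crank b (stack_edge r W s) z)).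
    apply: (contra s 0 true sk k0 K0 miss zm) => [j jr|j j' jr j'r oj oj'].
      by have := column_growth WP (leq0n s) sk jr; case: odd => /=; lia.
    apply: (@vertices_far _ k r W b WP 0 k.-1) => //; first exact: ne oj oj'.
      have := column_growth WP (leq0n k.-1) kK jr; move: oj.
      by rewrite subn0; case: odd.
    have := column_growth WP (leq0n k.-1) kK j'r; move: oj'.
    by rewrite subn0; case: odd.
  have sK : s <= k.-1 by lia.
  apply: (contra s k.-1 false sk kK K0 miss zm) => [j jr|j j' jr j'r oj oj'].
    by have := column_growth WP sK kK jr; case: odd => /=; lia.
  apply: (@vertices_far _ k r W b WP k.-1 0) => //; first exact: ne oj oj'.
    have := column_growth WP (leq0n k.-1) kK jr; move: oj.
    by rewrite subn0; case: odd.
  have := column_growth WP (leq0n k.-1) kK j'r; move: oj'.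
  by rewrite subn0; case: odd.
have /fin_all_exists2[x xe xK] : forall s : 'I_k, exists2 x, x \in stack_edge r W s & x < k.-1.
  by move=> s; apply: hit.
pose g (s : 'I_k) : 'I_k.-1 := Ordinal (xK s).
suff : #|'I_k| <= #|'I_k.-1| by rewrite !card_ord; lia.
apply: (@leq_card _ _ g) => s s' /(congr1 (@nat_of_ord _)) /= /val_inj xE.
have /imsetP[j _ E] := xe s; have /imsetP[j' _ E'] := xe s'.
apply: val_inj.
by have [] := stack_vertex_inj WP (ltn_ord s) (ltn_ord s') (ltn_ord j) (ltn_ord j') _; rewrite -?E -?E'.
Qed.

(** * Lower bound: counting the edges *)

Lemma rankD1 n (S : {set 'I_n}) (m a : 'I_n) : a <= m -> rank (S :\ m) a = rank S a.
Proof.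
move=> am; apply: eq_card => c; rewrite !inE; case: eqVneq => [->|//].
by rewrite [m < a]ltnNge am !andbF.
Qed.

Lemma rankU1 n (S : {set 'I_n}) (m : 'I_n) (a : nat) :
  m \notin S -> rank (m |: S) a = (m < a) + rank S a.
Proof.
move=> mS; rewrite /rank; case: ltnP => ma.
  rewrite add1n (_ : [set c in m |: S | c < a] = m |: [set c in S | c < a]).
    by rewrite cardsU1 inE (negbTE mS).
  by apply/setP => c; rewrite !inE; case: eqVneq => [->|//]; rewrite ma.
apply: eq_card => c; rewrite !inE; case: eqVneq => [->|//].
by rewrite (negbTE mS) ltnNge ma.
Qed.

(** The ranks in S are 0, ..., |S| - 1; the induction removes the maximum, which leaves the other
    ranks unchanged. *)
Lemma card_odd_rank n (S : {set 'I_n}) :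
  #|[set a in S | odd (rank S a)]| = #|S|./2.
Proof.
elim: {S}_.+1 {-2}S (ltnSn #|S|) => // N IH S SN.
have [->|[x0 x0S]] := set_0Vmem S.
  by rewrite cards0; apply: eq_card0 => a; rewrite !inE.
pose m := [arg max_(x > x0 in S) (x : nat)].
have [mS mmax] : m \in S /\ forall y : 'I_n, y \in S -> y <= m.
  by rewrite /m; case: arg_maxnP.
have cS : #|S| = #|S :\ m|.+1 by rewrite (cardsD1 m S) mS.
have rm : rank S m = #|S :\ m|.
  apply: eq_card => c; rewrite !inE -val_eqE /=; case: (boolP (c \in S)) => cS'; rewrite ?andbF //.
  by rewrite andbT ltn_neqAle mmax // andbT.
have -> : [set a in S | odd (rank S a)] =
    (if odd #|S :\ m| then [set m] else set0) :|: [set a in S :\ m | odd (rank (S :\ m) a)].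
  apply/setP => a; rewrite !inE; case: (eqVneq a m) => [->|am].
    by rewrite mS rm andbT andFb orbF; case: ifP; rewrite !inE ?eqxx.
  case: (boolP (a \in S)) => aS /=; last by case: ifP; rewrite !inE ?(negbTE am).
  by rewrite rankD1 ?mmax //; case: ifP; rewrite !inE ?(negbTE am).
have IHm := IH (S :\ m) _; rewrite cS; move: (cS); rewrite cardsU IHm; last by rewrite -ltnS -cS.
move=> _; rewrite (_ : _ :&: _ = set0) ?cards0 ?subn0; last first.
  by apply/setP => a; rewrite !inE; case: ifP; rewrite !inE; case: eqVneq.
by rewrite -uphalfE uphalf_half; case: ifP; rewrite ?cards1 ?cards0.
Qed.

Lemma card_ord_window n lo len : #|[set x : 'I_n | lo <= x < lo + len]| <= len.
Proof.
case: n => [|n]; first by rewrite (leq_trans (max_card _)) ?card_ord.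
apply: (@leq_trans #|[set (inord (lo + d) : 'I_n.+1) | d : 'I_len]|); last first.
  by rewrite (leq_trans (leq_imset_card _ _)) // card_ord.
apply: subset_leq_card; apply/subsetP => x; rewrite inE => /andP[h1 h2].
have dl : x - lo < len by lia.
by apply/imsetP; exists (Ordinal dl) => //; apply: val_inj; rewrite /= subnKC // inord_val.
Qed.

(** The places an element of a [spread] set must avoid, so that the K points at the cut and the 2K
    points after each element exist, are disjoint and miss the set. *)
Definition crowded n K (S : {set 'I_n}) : {set 'I_n} :=
  [set b : 'I_n | [|| b < K, n <= b + K.*2 | [exists a in S, a < b <= a + K.*2]]].

Definition spread n K (S : {set 'I_n}) : bool :=
  [forall b in S, b \notin crowded K S].

Definition extensions n K (S : {set 'I_n}) : {set 'I_n} :=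
  [set b : 'I_n | (b < K) || [exists a in S, odd (rank S a) && (a < b <= a + K.*2)]].

Lemma spreadP n K (S : {set 'I_n}) b : spread K S -> b \in S ->
  [/\ K <= b, b + K.*2 < n & forall a, a \in S -> a < b -> a + K.*2 < b].
Proof.
move=> /forall_inP/(_ b) sp /sp; rewrite inE !negb_or -leqNgt -ltnNge.
case/and3P => h1 h2 /exists_inPn h3; split=> // a aS ab.
by have := h3 a aS; lia.
Qed.

(** The 3K counts K points at the start and 2K at the end of the numbering. *)
Lemma card_crowded n K (S : {set 'I_n}) : #|crowded K S| <= 3 * K + #|S| * K.*2.
Proof.
case: n S => [|n] S.
  by rewrite (leq_trans (max_card _)) ?card_ord.
pose F (p : 'I_n.+1 * 'I_K.*2) : 'I_n.+1 := inord (p.1 + p.2.+1).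
apply: (@leq_trans #|[set x : 'I_n.+1 | 0 <= x < 0 + K] :|:
   [set x : 'I_n.+1 | n.+1 - K.*2 <= x < n.+1 - K.*2 + K.*2] :|: F @: setX S setT|).
  apply: subset_leq_card; apply/subsetP => b; rewrite !inE.
  case/or3P => [->//|h|/exists_inP[a aS ab]].
    by apply/orP; left; apply/orP; right; have := ltn_ord b; lia.
  have dl : b - a.+1 < K.*2 by lia.
  apply/orP; right; apply/imsetP; exists (a, Ordinal dl); rewrite ?inE ?aS //.
  by apply: val_inj; rewrite /F /= inordK; have := ltn_ord b; lia.
apply: leq_trans (leq_card_setU _ _) _; apply: leq_add.
  apply: leq_trans (leq_card_setU _ _) _.
  by have := card_ord_window n.+1 0 K; have := card_ord_window n.+1 (n.+1 - K.*2) K.*2; lia.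
by rewrite (leq_trans (leq_imset_card _ _)) // cardsX cardsT card_ord.
Qed.

(** There are K points at the cut and 2K after each of the (|S| - 1)/2 elements of odd rank, all
    distinct because S is spread. *)
Lemma card_extensions n K (S : {set 'I_n}) : spread K S -> 0 < #|S| -> odd #|S| ->
  K * #|S| <= #|extensions K S|.
Proof.
case: n S => [|n] S sp S0 oS.
  by move: S0; rewrite ltnNge (leq_trans (max_card _)) ?card_ord.
have [x0 x0S] := card_gt0P S0; have [x0K x0n _] := spreadP sp x0S.
pose F (p : 'I_n.+1 * 'I_K.*2) : 'I_n.+1 := inord (p.1 + p.2.+1).
pose A := setX [set a in S | odd (rank S a)] [set: 'I_K.*2].
have FE p : p \in A -> F p = p.1 + p.2.+1 :> nat.
  case: p => a d; rewrite !inE /= andbT => /andP[aS _]; rewrite inordK //=.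
  by have [_ h _] := spreadP sp aS; have := ltn_ord d; lia.
have Finj : {in A &, injective F}.
  move=> p p' pA p'A /(congr1 (@nat_of_ord _)); rewrite !FE //.
  case: p p' pA p'A => [a d] [a' d']; rewrite !inE /= !andbT => /andP[aS _] /andP[a'S _] E.
  have [_ _ h] := spreadP sp aS; have [_ _ h'] := spreadP sp a'S.
  have := ltn_ord d; have := ltn_ord d' => dl dl'.
  have aa : a = a'.
    apply: val_inj => /=; case: (ltngtP a a') => // lt.
      by have := h' a aS lt; lia.
    by have := h a' a'S lt; lia.
  by subst; congr (_, _); apply: val_inj => /=; lia.
have cA : #|F @: A| = #|S|./2 * K.*2.
  by rewrite card_in_imset // cardsX cardsT card_ord card_odd_rank.
have K_lt : K <= n.+1 by lia.
have -> : K * #|S| = #|[set x : 'I_n.+1 | x < K] :|: F @: A|.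
  rewrite cardsU cA card_ord_lt // (_ : _ :&: _ = set0) ?cards0; last first.
    apply/setP => x; rewrite !inE; apply/negP => /andP[xK /imsetP[p pA xE]].
    move: xK; rewrite xE FE //; move: pA; rewrite !inE /= andbT => /andP[aS _].
    by have [h _ _] := spreadP sp aS; lia.
  by rewrite subn0 -{1}(odd_double_half #|S|) oS; lia.
apply: subset_leq_card; apply/subsetP => x; rewrite !inE.
case/orP => [->//|/imsetP[[a d] pA xE]]; apply/orP; right.
have := FE _ pA; rewrite -xE /= => xE'; move: pA; rewrite !inE /= andbT => /andP[aS oa].
by apply/exists_inP; exists a => //; rewrite oa xE'; have := ltn_ord d; lia.
Qed.

Lemma extensions_notin n K (S : {set 'I_n}) b : spread K S ->
  b \in extensions K S -> b \notin S.
Proof.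
move=> sp; rewrite inE => h; apply/negP => /(spreadP sp)[h1 _ h3].
case/orP: h => [|/exists_inP[a aS /andP[_ ab]]]; first by lia.
by have := h3 a aS; lia.
Qed.

(** If the added points differ, each lies in the other spread set. It is thus not among the first K
    points, and the element it closely follows can only be the other added point; each would then
    come after the other. *)
Lemma extensions_setU1_inj n K (S S' : {set 'I_n}) b b' :
  spread K S -> spread K S' -> b \in extensions K S -> b' \in extensions K S' ->
  b |: S = b' |: S' -> (S, b) = (S', b').
Proof.
move=> sp sp' be be' E.
have bS := extensions_notin sp be; have b'S' := extensions_notin sp' be'.
suff bb : b = b' by subst b'; rewrite -(setU1K bS) E setU1K.
apply/eqP; apply: contraT => bb.
have lt (T T' : {set 'I_n}) c c' : spread K T -> spread K T' -> c' \in extensions K T' ->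
    c |: T = c' |: T' -> c != c' -> c < c'.
  move=> t t' ce TE cc; have : c' \in c |: T by rewrite TE setU11.
  rewrite !inE eq_sym (negbTE cc) /= => c'T; have [h1 _ h3] := spreadP t c'T.
  move: ce; rewrite inE => /orP[|/exists_inP[a aT' /andP[_ /andP[ac ac']]]].
    by rewrite ltnNge h1.
  have : a \in c |: T by rewrite TE !inE aT' orbT.
  rewrite !inE => /orP[/eqP<-//|aT].
  by have := h3 a aT ac; rewrite ltnNge ac'.
have b_lt := lt _ _ _ _ sp sp' be' E bb; rewrite eq_sym in bb.
by have := lt _ _ _ _ sp' sp be (esym E) bb; rewrite ltnNge ltnW.
Qed.

(** No element of S lies between [a] and [b], so [b] takes the even rank following that of [a],
    while [a], being before [b], keeps its odd rank. *)
Lemma extension_lower_cgh n r K (S : {set 'I_n}) b : #|S| = r -> spread K S ->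
  b \in extensions K S -> b |: S \in lower_cgh n r.+1 K.
Proof.
move=> Sr sp be; have bS := extensions_notin sp be.
rewrite inE cardsU1 bS Sr eqxx /=; apply/orP.
move: be; rewrite inE => /orP[bK|/exists_inP[a aS /andP[oa ab]]].
  by left; apply/exists_inP; exists b; rewrite ?setU11.
right; apply/exists_inP; exists a; first by rewrite !inE aS orbT.
apply/exists_inP; exists b; first exact: setU11.
rewrite ab !rankU1 // ltnn add0n (_ : b < a = false) ?oa /=; last by lia.
suff -> : rank S b = (rank S a).+1 by rewrite /= oa.
rewrite /rank (_ : [set c in S | c < b] = a |: [set c in S | c < a]).
  by rewrite cardsU1 inE ltnn andbF.
apply/setP => c; rewrite !inE -val_eqE /=; case: (boolP (c \in S)) => cS /=; last first.
  by rewrite orbF; apply/esym/eqP => ca; move: cS; rewrite (val_inj ca) aS.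
have [_ _ h] := spreadP sp cS; have := h a aS.
by case: (ltngtP c a) => ca /=; lia.
Qed.

(** Such a set contains an element crowded by the remaining [m] elements. *)
Lemma card_not_spread n K m :
  #|[set S : {set 'I_n} | (#|S| == m.+1) && ~~ spread K S]| <=
  'C(n, m) * (3 * K + m * K.*2).
Proof.
pose Y := [set p : {set 'I_n} * 'I_n |
  (p.1 \in [set S : {set 'I_n} | #|S| == m]) && (p.2 \in crowded K p.1)].
apply: (@leq_trans #|Y|); last first.
  rewrite (card_sigma _ (@crowded n K)) -[X in 'C(X, _)](card_ord n) -card_draws -sum_nat_const.
  by apply: leq_sum => S; rewrite inE => /eqP Sm; rewrite -Sm card_crowded.
apply: leq_trans (leq_imset_card (fun p : {set 'I_n} * 'I_n => p.2 |: p.1) Y).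
apply: subset_leq_card; apply/subsetP => S; rewrite inE => /andP[/eqP Sm].
case/forall_inPn => b bS; rewrite negbK => bc; apply/imsetP; exists (S :\ b, b).
  have Sb : #|S :\ b| = m by move: Sm; rewrite (cardsD1 b) bS add1n => -[].
  rewrite !inE /= Sb eqxx /=.
  move: bc; rewrite inE => /or3P[->//|->|/exists_inP[a aS ab]]; rewrite ?orbT //.
  apply/orP; right; apply/orP; right; apply/exists_inP; exists a => //.
  by rewrite !inE aS andbT; apply: contraTneq ab => ->; rewrite ltnn.
by rewrite /= setD1K.
Qed.

(** Each spread set contributes at least [K * r.+1] edges, and different pairs of a spread set and
    an extension give different edges. The last term pays for the sets that are not spread. *)
Lemma card_lower_cgh n r K : ~~ odd r ->
  K * r.+1 * 'C(n, r.+1) <=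
  #|lower_cgh n r.+2 K| + K * r.+1 * (3 * K + r * K.*2) * n ^ r.
Proof.
move=> re; pose G := [set S : {set 'I_n} | (#|S| == r.+1) && spread K S].
have Gc : 'C(n, r.+1) <= #|G| + 'C(n, r) * (3 * K + r * K.*2).
  rewrite -[X in 'C(X, r.+1)](card_ord n) -card_draws.
  rewrite -(cardsID [set S | spread K S] [set S : {set 'I_n} | #|S| == r.+1]).
  apply: leq_add.
    by apply: subset_leq_card; apply/subsetP => S; rewrite !inE.
  apply: leq_trans (card_not_spread n K r); apply: subset_leq_card.
  by apply/subsetP => S; rewrite !inE andbC.
have bin_le : 'C(n, r) <= n ^ r.
  rewrite -(leq_pmul2r (fact_gt0 r)) bin_ffact.
  apply: (@leq_trans (n ^ r)); last by rewrite leq_pmulr ?fact_gt0.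
  elim: r {re G Gc} => [|r IH]; first by rewrite ffactn0.
  by rewrite ffactnSr expnSr leq_mul // leq_subr.
have Hc : #|G| * (K * r.+1) <= #|lower_cgh n r.+2 K|.
  pose X := [set p : {set 'I_n} * 'I_n | (p.1 \in G) && (p.2 \in extensions K p.1)].
  apply: (@leq_trans #|X|).
    rewrite (card_sigma G (@extensions n K)) -sum_nat_const; apply: leq_sum => S.
    rewrite inE => /andP[/eqP SE sp]; rewrite -SE.
    by apply: card_extensions => //; rewrite SE //= re.
  rewrite -(card_in_imset (f := fun p : {set 'I_n} * 'I_n => p.2 |: p.1) (D := X)).
    apply: subset_leq_card; apply/subsetP => e /imsetP[[S b]].
    rewrite inE /= => /andP[SG be] ->; move: SG; rewrite inE => /andP[/eqP SE sp].
    exact: extension_lower_cgh be.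
  move=> [S b] [S' b']; rewrite inE /= => /andP[SG be]; rewrite inE /= => /andP[SG' be'].
  move: SG SG'; rewrite !inE => /andP[_ sp] /andP[_ sp'].
  exact: extensions_setU1_inj sp sp' be be'.
move: Gc bin_le Hc; move: 'C(n, r) 'C(n, r.+1) #|G| #|lower_cgh _ _ _| (n ^ r) (3 * K + r * K.*2).
move=> c c' g h x y h1 h2 h3.
apply: leq_trans (leq_mul (leqnn (K * r.+1)) h1) _.
rewrite mulnDr; apply: leq_add; first by rewrite mulnC.
by rewrite -(mulnA (K * r.+1) y x) leq_mul2l [c * y]mulnC leq_mul2l h2 !orbT.
Qed.

(** * The asymptotic formula *)

Theorem theorem4p1 (k r : nat) (k_ge1 : 1 <= k) (r_ge2 : 2 <= r)
    (r_even : ~~ odd r) :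
  exists C N : nat, forall (m : nat) (M : cgh m), is_stack k r M ->
    forall n : nat, N <= n ->
      (`|(ex_cgh r n M)%:Z - ((k - 1) * (r - 1) * 'C(n, r - 1))%N%:Z|
        <= (C * n ^ (r - 2))%N%:Z)%R.
Proof.
case: r r_ge2 r_even => [|[|r]] // _; rewrite /= negbK => re.
case: k k_ge1 => // k _.
(* From here [k] and [r] stand for the original k - 1 and r - 2. The constant is that of
   [card_lower_cgh], which holds for all n, hence the threshold 0. *)
exists (k * r.+1 * (3 * k + r * k.*2)), 0 => m M stM n _.
rewrite !subSS !subn0.
have upper : ex_cgh r.+2 n M <= k * r.+1 * 'C(n, r.+1).
  apply/bigmax_leqP => H /andP[Hu]; rewrite leqNgt; apply: contra => Hbig.
  by apply/(contains_stackP _ _ _ stM) => //; apply: stack_of_many_edges.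
have lower : #|lower_cgh n r.+2 k| <= ex_cgh r.+2 n M.
  apply: leq_bigmax_cond; apply/andP; split.
    by apply/forall_inP => e; rewrite inE => /andP[].
  apply/negP => /(contains_stackP _ _ _ stM)[//|//|W [b [WP We]]].
  by apply: (lower_cgh_stack_free (k := k.+1) _ _ WP We); rewrite //= negbK.
have := card_lower_cgh n k re; move: upper lower.
move: (ex_cgh _ _ _) (#|lower_cgh _ _ _|) (_ * 'C(_, _)) (_ * n ^ r).
by move=> *; lia.
Qed.
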